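(* Fix $r\in\{0,1\}$ and $n\ge 0$. Let $\pi\in B_n$ be a hyperoctahedral involution with exactly $d$ barred two-cycles. Then the sign of its domino insertion tableau satisfies \[ \mathrm{sign}\big(P_d^r(\pi)\big)=(-1)^{d}. \]
   Context: Partitions are identified with Young diagrams in English notation: cell $(k,l)$ lies in row $k$ (rows numbered $1,2,\dots$ from top to bottom) and column $l$ (columns numbered $1,2,\dots$ from left to right). A domino is a set of two cells sharing an edge; it is vertical if both cells lie in the same column, horizontal otherwise. For $r\ge0$ let $\delta_r=(r,r-1,\dots,1)$ ($\delta_0=\emptyset$). Every partition $\lambda$ has a 2-core $\tilde\lambda$ (obtained by repeatedly removing dominoes whose removal leaves a partition, until impossible), which equals $\delta_r$ for a unique $r$. $\mathcal P_r(n)$ denotes the set of partitions with 2-core $\delta_r$ and size $|\delta_r|+2n$. A standard domino tableau (SDT) of shape $\lambda\in\mathcal P_r(n)$ is a chain of partitions $\delta_r=\lambda^0\subset\lambda^1\subset\cdots\subset\lambda^n=\lambda$ with each $\lambda^k/\lambda^{k-1}$ a domino, called the domino with value $k$. Its spin $sp(D)$ is half the number of vertical dominoes. Signed permutations: $B_n$ is the set of words $\pi=\pi_1\cdots\pi_n$ in letters from $\{1,\dots,n,\bar1,\dots,\bar n\}$ such that each $k\in[n]$ occurs exactly once, barred or unbarred. $\pi$ is an involution if for each $k\in[n]$ either $\pi_k=k$ (fixed point), $\pi_k=\bar k$ (barred fixed point), or there is $l\ne k$ with $\pi_k=l,\pi_l=k$ (two-cycle $\{k,l\}$) or with $\pi_k=\bar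 l,\pi_l=\bar k$ (barred two-cycle $\{k,l\}$). Domino insertion via growth diagrams: for $\pi\in B_n$ let $M(i,j)=1$ if $\pi_i=j$, $M(i,j)=-1$ if $\pi_i=\bar j$, $M(i,j)=0$ otherwise ($i,j\in[n]$). The growth diagram is the array of partitions $\lambda_{(i,j)}$, $1\le i,j\le n+1$, with $\lambda_{(1,j)}=\lambda_{(i,1)}=\delta_r$, and, for $i,j\in[n]$, writing $\lambda=\lambda_{(i,j)},\mu=\lambda_{(i+1,j)},\nu=\lambda_{(i,j+1)}$, $\rho=\lambda_{(i+1,j+1)}$ is determined by: (1) if $M(i,j)=1$ (then $\lambda=\mu=\nu$), $\rho$ is $\lambda$ with two cells appended to its first row; (2) if $M(i,j)=-1$ (then $\lambda=\mu=\nu$), $\rho$ is $\lambda$ with two cells appended to its first column; (3) if $M(i,j)=0$ and $\lambda=\mu$ or $\lambda=\nu$, $\rho$ is the largest of $\lambda,\mu,\nu$; (4) otherwise $M(i,j)=0$ and $\gamma=\nu/\lambda$, $\gamma'=\mu/\lambda$ are dominoes: if $\gamma\cap\gamma'=\emptyset$ then $\rho=\lambda\cup\gamma\cup\gamma'$; if $\gamma\cap\gamma'$ is a single cell $(k,l)$ then $\rho=\lambda\cup\gamma\cup\gamma'\cup\{(k+1,l+1)\}$; if $\gamma=\gamma'$ is vertical in column $l$, $\rho$ is $\lambda\cup\gamma$ with two cells appended to the bottom of column $l+1$; if $\gamma=\gamma'$ is horizontal in row $k$, $\rho$ is $\lambda\cup\gamma$ with two cells appended to the end of row $k+1$. These rules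 are well defined, and consecutive partitions in the last row and last column differ by exactly one domino. The insertion tableau $P_d^r(\pi)$ is the SDT given by the chain $\lambda_{(n+1,1)}\subset\lambda_{(n+1,2)}\subset\cdots\subset\lambda_{(n+1,n+1)}$ and the recording tableau $Q_d^r(\pi)$ is the SDT given by $\lambda_{(1,n+1)}\subset\lambda_{(2,n+1)}\subset\cdots\subset\lambda_{(n+1,n+1)}$. Sign of an SDT $D$ with 2-core $\delta_0$ or $\delta_1$: let $T(D)$ be the standard Young tableau obtained (for $r=0$) by filling the two cells of the domino with value $k$ with $2k-1,2k$, or (for $r=1$) by putting $1$ in the core cell and filling the domino with value $k$ with $2k,2k+1$, in each case the smaller number in the left (horizontal domino) or upper (vertical domino) cell. The reading word of a standard Young tableau reads the rows from top to bottom, each from left to right; $\mathrm{sign}(D)$ is the sign of the reading word of $T(D)$ as a permutation. *)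

(* Defs.v *)
From mathcomp Require Import all_boot all_order all_algebra all_fingroup.
Set Implicit Arguments. Unset Strict Implicit. Unset Printing Implicit Defensive.
Import GRing.Theory.

(* Conventions: rows and columns are numbered from 0 (the paper numbers from 1;
   all rules are invariant under this shift).  A partition is encoded as the
   seq of its (positive) row lengths, weakly decreasing; cell (k,l) lies in
   partition p iff l < nth 0 p k. *)
Definition partition := seq nat.
Definition prow (p : partition) (k : nat) : nat := nth 0 p k.
Definition in_part (p : partition) (c : nat * nat) : bool := c.2 < prow p c.1.

Definition delta (r : nat) : partition := rev (iota 1 r).

Definition skew_cells (nu lam : partition) : seq (nat * nat) :=
  flatten [seq [seq (k, l) | l <- iota (prow lam k) (prow nu k - prow lam k)]
          | k <- iota 0 (size nu)].

Fixpoint punion (a b : partition) : partition :=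
  match a, b with
  | [::], _ => b
  | _, [::] => a
  | x :: a', y :: b' => maxn x y :: punion a' b'
  end.

Definition add_cell (p : partition) (c : nat * nat) : partition :=
  set_nth 0 p c.1 (maxn (prow p c.1) c.2.+1).

Definition col_len (p : partition) (l : nat) : nat := count (fun x => l < x) p.

(* Local growth rule: rho from M(i,j) = m, lam = lambda_(i,j),
   mu = lambda_(i+1,j), nu = lambda_(i,j+1). *)
Definition grow_rule (m : int) (lam mu nu : partition) : partition :=
  if m == 1%R then set_nth 0 lam 0 (prow lam 0).+2
  else if m == (-1)%R then lam ++ [:: 1; 1]
  else if (lam == mu) || (lam == nu) then
    (if lam == mu then nu else mu)
  else
    let g := skew_cells nu lam in
    let g' := skew_cells mu lam in
    let common := [seq c <- g | c \in g'] in
    if size common == 0 then punion nu mu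
    else if size common == 1 then
      let c := head (0, 0) common in
      add_cell (punion nu mu) (c.1.+1, c.2.+1)
    else (* gamma = gamma' *)
      let c := head (0, 0) g in
      let c' := last (0, 0) g in
      if c.2 == c'.2 then
        let l := c.2 in
        let h := col_len nu l.+1 in
        add_cell (add_cell nu (h, l.+1)) (h.+1, l.+1)
      else
        set_nth 0 nu c.1.+1 (prow nu c.1.+1).+2.

(* Given row i of the growth diagram ps = [lambda_(i,1); ...; lambda_(i,n+1)],
   the entries ms = [M(i,1); ...; M(i,n)] and q = lambda_(i+1,1),
   compute row i+1. *)
Fixpoint next_row (ms : seq int) (ps : seq partition) (q : partition)
  : seq partition :=
  match ms, ps with
  | m :: ms', p :: ((p' :: _) as ps') => q :: next_row ms' ps' (grow_rule m p q p')
  | _, _ => [:: q]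
  end.

(* growth_row r Mf n i = [lambda_(i+1,1); ...; lambda_(i+1,n+1)], where
   Mf i j (0-indexed) is the entry M(i+1,j+1) of the paper. *)
Fixpoint growth_row (r : nat) (Mf : nat -> nat -> int) (n i : nat)
  : seq partition :=
  match i with
  | 0 => nseq n.+1 (delta r)
  | i'.+1 => next_row [seq Mf i' j | j <- iota 0 n] (growth_row r Mf n i') (delta r)
  end.

(* Signed permutations of B_n: pi_(i) = sigma(i), barred iff s i
   (positions and values 0-indexed). *)
Definition signed_matrix (n : nat) (sigma : {perm 'I_n}) (s : {ffun 'I_n -> bool})
  : nat -> nat -> int :=
  fun i j =>
    match (insub i : option 'I_n), (insub j : option 'I_n) with
    | Some i', Some j' => if sigma i' == j' then (if s i' then (-1)%R else 1%R) else 0%R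
    | _, _ => 0%R
    end.

(* The insertion tableau P_d^r(pi), as the chain
   lambda_(n+1,1) c lambda_(n+1,2) c ... c lambda_(n+1,n+1). *)
Definition insertion_tableau (r n : nat) (sigma : {perm 'I_n})
  (s : {ffun 'I_n -> bool}) : seq partition :=
  growth_row r (signed_matrix sigma s) n n.

Definition signed_involution (n : nat) (sigma : {perm 'I_n})
  (s : {ffun 'I_n -> bool}) : Prop :=
  forall k : 'I_n,
    (sigma k = k /\ s k = false) \/ (sigma k = k /\ s k = true) \/
    exists l : 'I_n, l <> k /\
      ((sigma k = l /\ s k = false /\ sigma l = k /\ s l = false) \/
       (sigma k = l /\ s k = true /\ sigma l = k /\ s l = true)).

Definition barred_two_cycles (n : nat) (sigma : {perm 'I_n})
  (s : {ffun 'I_n -> bool}) : nat :=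
  #|[set p : 'I_n * 'I_n | [&& p.1 < p.2, sigma p.1 == p.2, sigma p.2 == p.1,
                              s p.1 & s p.2]]|.

(* Sign of a standard domino tableau given as a chain ch = [c_0 = delta_r; ...; c_n]
   (r in {0,1}).  The filling T(D): the core cell (r = 1) gets 1, the domino with
   value m gets 2m-1+r and 2m+r, the smaller number in its left (horizontal) or
   upper (vertical) cell. *)
Definition domino_value (ch : seq partition) (c : nat * nat) : nat :=
  count (fun p => ~~ in_part p c) ch.

Definition tableau_entry (r : nat) (ch : seq partition) (c : nat * nat) : nat :=
  let m := domino_value ch c in
  if m == 0 then 1 else
  let dom := skew_cells (nth [::] ch m) (nth [::] ch m.-1) in
  let o := head (0, 0) [seq c' <- dom | c' != c] in
  let first := ((c.1 == o.1) && (c.2 < o.2)) || ((c.2 == o.2) && (c.1 < o.1)) in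
  if first then (m.*2.-1 + r)%N else (m.*2 + r)%N.

Definition reading_word (r : nat) (ch : seq partition) : seq nat :=
  let lam := last [::] ch in
  flatten [seq [seq tableau_entry r ch (k, l) | l <- iota 0 (prow lam k)]
          | k <- iota 0 (size lam)].

Definition inversions (w : seq nat) : nat :=
  \sum_(i < size w) \sum_(j < size w | i < j) (nth 0 w j < nth 0 w i).

Definition sdt_sign (r : nat) (ch : seq partition) : int :=
  ((-1) ^+ inversions (reading_word r ch))%R.

(* Main.v *)
(** Inserting the two largest letters shows that a new domino changes the sign of
    the reading word iff it is vertical in an odd column (0-indexed); call the
    number of these dominoes e, and v the number of all vertical dominoes.  Two
    invariants of the growth diagram determine e.

    First, the number of rows of odd length is unchanged by a horizontal domino
    and changes by +2 or -2 according as a vertical domino lies in an even or an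
    odd column, so along any chain it grows by 2 v - 4 e.  For an involution the
    growth diagram is symmetric, and along its diagonal this number changes only
    at barred fixed points, by 2: a symmetric square with M(i,i) = 0 adds either
    two horizontal dominoes or two vertical ones in adjacent columns.

    Second (colour-to-spin), in each square the vertical dominoes on the two
    outgoing edges are as many as those on the two incoming ones, plus 2 if
    M(i,j) = -1.  Hence the insertion and recording tableaux together have twice
    as many vertical dominoes as there are bars, and by symmetry v is the number
    of bars.

    So 2 (barred fixed points) = 2 (bars) - 4 e, that is, e = d. *)

Require Import Defs.
From mathcomp Require Import all_boot all_order all_algebra all_fingroup.
From mathcomp Require Import zify.
Import GRing.Theory.
Set Implicit Arguments. Unset Strict Implicit. Unset Printing Implicit Defensive.

(** * Partitions and dominoes *)

Arguments prow : simpl never.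

(** Positivity below [size p] rules out trailing zeros, so a partition is determined by its
    row-length function [prow], which is 0 past the end. *)
Definition is_part (p : seq nat) : Prop :=
  (forall i, prow p i.+1 <= prow p i) /\ (forall i, i < size p -> 0 < prow p i).

Lemma prow_default p i : size p <= i -> prow p i = 0.
Proof. exact: nth_default. Qed.

Lemma prow_gt0 p i : is_part p -> (0 < prow p i) = (i < size p).
Proof.
by move=> [_ pos]; case: (ltnP i) => [/pos ->|/prow_default ->].
Qed.

Lemma prow_anti p i j : is_part p -> i <= j -> prow p j <= prow p i.
Proof.
move=> [mono _]; elim: j => [|j IH]; first by rewrite leqn0 => /eqP ->.
rewrite leq_eqVlt => /predU1P[-> //|/IH]; exact: leq_trans.
Qed.

Lemma part_ext p q : is_part p -> is_part q -> prow p =1 prow q -> p = q.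
Proof.
move=> pp pq epq.
have es : size p = size q.
  apply: contraTeq isT; rewrite neq_ltn.
  rewrite -(prow_gt0 (size p) pq) -(prow_gt0 (size q) pp) epq -(epq (size p)).
  by rewrite !prow_default.
by apply: (@eq_from_nth _ 0) => // i _; apply: epq.
Qed.

Lemma prow_set_nth p k x i :
  prow (set_nth 0 p k x) i = if i == k then x else prow p i.
Proof. by rewrite /prow nth_set_nth. Qed.

(** If [k] lies beyond the end of [p], [set_nth] pads with zeros; monotonicity makes every row above
    [k] at least [x], so no padding zero can occur. *)
Lemma is_part_set_nth p k x : is_part p -> 0 < x ->
  (forall i, prow (set_nth 0 p k x) i.+1 <= prow (set_nth 0 p k x) i) ->
  is_part (set_nth 0 p k x).
Proof.
move=> pp x0 mono; split=> // i; rewrite size_set_nth leq_max ltnS.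
have anti j : prow (set_nth 0 p k x) (i + j) <= prow (set_nth 0 p k x) i.
  by elim: j => [|j IH]; rewrite ?addn0 // addnS (leq_trans (mono _)).
case: (leqP i k) => [leik _|ltki /=].
  have := anti (k - i); rewrite subnKC // => /(leq_trans _); apply.
  by rewrite prow_set_nth eqxx.
by rewrite prow_set_nth gtn_eqF // => /(pp.2).
Qed.

Lemma prow_punion a b i : prow (punion a b) i = maxn (prow a i) (prow b i).
Proof.
rewrite /prow; elim: a b i => [|x a IH] [|y b] [|i] //=; rewrite ?nth_nil ?max0n ?maxn0 //.
Qed.

Lemma size_punion a b : size (punion a b) = maxn (size a) (size b).
Proof. by elim: a b => [|x a IH] [|y b] //=; rewrite IH maxnSS. Qed.

Lemma is_part_punion a b : is_part a -> is_part b -> is_part (punion a b).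
Proof.
move=> pa pb; split=> i; rewrite !prow_punion.
  have := pa.1 i; have := pb.1 i; lia.
by rewrite size_punion !leq_max !prow_gt0.
Qed.

Lemma punionC a b : punion a b = punion b a.
Proof. by elim: a b => [|x a IH] [|y b] //=; rewrite maxnC IH. Qed.

Definition hstep (k : nat) (lam mu : seq nat) : Prop :=
  forall i, prow mu i = prow lam i + (i == k).*2.

(** The first clause puts both cells in one column; the increments alone would allow two different
    columns. The upper cell is in row [k]. *)
Definition vstep (k : nat) (lam mu : seq nat) : Prop :=
  prow lam k.+1 = prow lam k /\
  forall i, prow mu i = prow lam i + ((i == k) || (i == k.+1)).

Variant dstep (lam mu : seq nat) : Prop :=
| DHoriz k of hstep k lam mu
| DVert k of vstep k lam mu.

Definition vert (lam mu : seq nat) : bool :=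
  has (fun i => prow mu i == (prow lam i).+1) (iota 0 (size mu)).

(** A cell added to row [i] lies in column [prow lam i], so this detects vertical dominoes in odd
    columns, those that change the sign. *)
Definition evert (lam mu : seq nat) : bool :=
  has (fun i => (prow mu i == (prow lam i).+1) && odd (prow lam i))
      (iota 0 (size mu)).

Definition oddrows (p : seq nat) : nat := count odd p.

Lemma vert_refl p : vert p p = false.
Proof. by apply/hasP=> -[i _]; rewrite ltn_eqF. Qed.

Lemma vert_h k lam mu : hstep k lam mu -> vert lam mu = false.
Proof. by move=> h; apply/hasP=> -[i _]; rewrite h; case: eqP; lia. Qed.

Lemma evert_h k lam mu : hstep k lam mu -> evert lam mu = false.
Proof. by move=> h; apply/hasP=> -[i _]; rewrite h; case: eqP; lia. Qed.

Lemma vstep_size k lam mu : is_part mu -> vstep k lam mu -> k.+1 < size mu.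
Proof. by move=> pm [_ h]; rewrite -prow_gt0 // h eqxx orbT addn1. Qed.

Lemma hstep_size k lam mu : is_part mu -> hstep k lam mu -> k < size mu.
Proof. by move=> pm h; rewrite -prow_gt0 // h eqxx addn2. Qed.

Lemma vert_v k lam mu : is_part mu -> vstep k lam mu -> vert lam mu.
Proof.
move=> pm v; apply/hasP; exists k; last by rewrite v.2 eqxx addn1.
by rewrite mem_iota; exact: ltnW (vstep_size pm v).
Qed.

Lemma evert_v k lam mu : is_part mu -> vstep k lam mu ->
  evert lam mu = odd (prow lam k).
Proof.
move=> pm v; apply/hasP/idP => [[i _]|ok].
  rewrite v.2; case: (i =P k) => [-> /andP[]//|_]; case: (i =P k.+1) => [->|_].
    by rewrite v.1 => /andP[].
  by rewrite addn0 ltn_eqF.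
exists k; last by rewrite v.2 eqxx addn1 eqxx.
by rewrite mem_iota; exact: ltnW (vstep_size pm v).
Qed.

Lemma oddrowsE p N : size p <= N -> oddrows p = \sum_(i < N) odd (prow p i).
Proof.
move=> leN; rewrite /oddrows -sum1_count big_mkcond /= (big_nth 0) big_mkord.
rewrite (big_ord_widen N (fun i => if odd (nth 0 p i) then 1 else 0)) //.
rewrite big_mkcond; apply: eq_bigr => i _.
rewrite -/(prow p i); case: (ltnP i (size p)) => [_|/prow_default -> //].
by case: odd.
Qed.

Lemma oddrows_h k lam mu : hstep k lam mu -> oddrows mu = oddrows lam.
Proof.
move=> h; rewrite !(@oddrowsE _ (size lam + size mu)) ?leq_addl ?leq_addr //.
by apply: eq_bigr => i _; rewrite h oddD odd_double addbF.
Qed.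

(** The two rows have equal length, so both flip parity in the same direction: two odd rows appear
    or two disappear. The loss stands on the left to avoid truncated subtraction. *)
Lemma oddrows_v k lam mu : is_part mu -> vstep k lam mu ->
  oddrows mu + 4 * odd (prow lam k) = oddrows lam + 2.
Proof.
move=> pm v; have ltk := vstep_size pm v.
set N := size lam + size mu.
have k1N : k.+1 < N by rewrite /N; lia.
have kN : k < N by lia.
rewrite !(@oddrowsE _ N) ?leq_addl ?leq_addr //.
pose P (i : 'I_N) := (i != Ordinal k1N) && (i != Ordinal kN).
have split2 (F : nat -> nat) :
    \sum_(i < N) F i = F k.+1 + (F k + \sum_(i < N | P i) F i).
  rewrite (bigD1 (Ordinal k1N)) //= (bigD1 (Ordinal kN)) //=.
  by rewrite -val_eqE /= ltn_eqF.
rewrite (split2 (fun i => odd (prow lam i))) (split2 (fun i => odd (prow mu i))).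
rewrite (eq_bigr (fun i : 'I_N => odd (prow lam i) : nat)); last first.
  move=> i /andP[]; rewrite -!val_eqE /= v.2 => /negPf -> /negPf ->.
  by rewrite addn0.
rewrite !v.2 v.1 !eqxx orbT /= !addn1 /=.
by case: odd => /=; lia.
Qed.

Lemma oddrows_d lam mu : is_part mu -> dstep lam mu ->
  oddrows mu + 4 * evert lam mu = oddrows lam + 2 * vert lam mu.
Proof.
move=> pm [k h|k v].
  by rewrite (oddrows_h h) (evert_h h) (vert_h h).
by rewrite (evert_v pm v) (vert_v pm v) (oddrows_v pm v).
Qed.

Lemma flatten_nil (T : Type) (f : nat -> seq T) s :
  (forall i, i \in s -> f i = [::]) -> flatten [seq f i | i <- s] = [::].
Proof.
elim: s => //= x s IH nil; rewrite nil ?mem_head // IH // => i si.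
by apply: nil; rewrite inE si orbT.
Qed.

Lemma iota_split1 k N : k < N ->
  iota 0 N = iota 0 k ++ k :: iota k.+1 (N - k.+1).
Proof.
move=> ltk; have {1}-> : N = k + (N - k.+1).+1 by lia.
by rewrite iotaD.
Qed.

Lemma skew_h k lam mu : is_part mu -> hstep k lam mu ->
  skew_cells mu lam = [:: (k, prow lam k); (k, (prow lam k).+1)].
Proof.
move=> pm h; rewrite /skew_cells (iota_split1 (hstep_size pm h)).
have nil i : i != k -> [seq (i, l) | l <- iota (prow lam i) (prow mu i - prow lam i)] = [::].
  by move=> /negPf ne; rewrite h ne addn0 subnn.
rewrite map_cat flatten_cat /= !flatten_nil ?cats0 /=.
- by rewrite h eqxx addKn.
- by move=> i; rewrite mem_iota => le; apply: nil; lia.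
- by move=> i; rewrite mem_iota => le; apply: nil; lia.
Qed.

Lemma skew_v k lam mu : is_part mu -> vstep k lam mu ->
  skew_cells mu lam = [:: (k, prow lam k); (k.+1, prow lam k)].
Proof.
move=> pm v; have ltk := vstep_size pm v.
rewrite /skew_cells (iota_split1 (ltnW ltk)).
have nil i : i != k -> i != k.+1 ->
   [seq (i, l) | l <- iota (prow lam i) (prow mu i - prow lam i)] = [::].
  by move=> /negPf ne /negPf ne'; rewrite v.2 ne ne' addn0 subnn.
have -> : size mu - k.+1 = (size mu - k.+2).+1 by lia.
rewrite map_cat flatten_cat /= !flatten_nil ?cats0 /=.
- by rewrite !v.2 !eqxx orbT v.1 /= !addKn.
- by move=> i; rewrite mem_iota => le; apply: nil; lia.
- by move=> i; rewrite mem_iota => le; apply: nil; lia.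
Qed.

Lemma dstep_neq lam mu : dstep lam mu -> lam != mu.
Proof.
case=> k; last case=> _; move=> h; apply/eqP=> e.
  by have := h k; rewrite e eqxx; lia.
by have := h k; rewrite e eqxx; lia.
Qed.

(** * The local growth rule *)

Lemma grow_pos lam mu nu :
  is_part lam -> let rho := grow_rule 1%R lam mu nu in
  is_part rho /\ hstep 0 lam rho.
Proof.
move=> pl rho; rewrite /rho /grow_rule eqxx.
set x := set_nth _ _ _ _.
have h : hstep 0 lam x.
  by move=> i; rewrite prow_set_nth; case: eqP => [->|_]; lia.
split=> //; apply: is_part_set_nth => // i.
by rewrite !h /=; have := pl.1 i; lia.
Qed.

Lemma grow_neg lam mu nu :
  is_part lam -> let rho := grow_rule (-1)%R lam mu nu in
  is_part rho /\ vstep (size lam) lam rho.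
Proof.
move=> pl rho; have -> : rho = lam ++ [:: 1; 1] by [].
have e i : prow (lam ++ [:: 1; 1]) i =
           prow lam i + ((i == size lam) || (i == (size lam).+1)).
  rewrite /prow nth_cat; case: ltnP => [lt|le].
    by rewrite !ltn_eqF ?addn0 // ltnW.
  rewrite [nth 0 lam i]nth_default // -{2 3}(subnKC le).
  by case: (i - size lam) => [|[|[|j]]] /=; lia.
split; last by split=> //; rewrite !prow_default.
split=> i; rewrite ?size_cat !e; last first.
  by have := prow_gt0 i pl; case: (ltnP i (size lam)) => [_|le] /=; lia.
have := pl.1 i; case: (ltnP i (size lam)) => [lt|le].
  have := prow_gt0 i pl; rewrite lt.
  case: (i.+1 =P size lam) => [es|]; last by lia.
  by rewrite [prow lam i.+1]prow_default ?es //; lia.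
by rewrite !(@prow_default lam); lia.
Qed.

Lemma grow_eql lam nu : grow_rule 0%R lam lam nu = nu.
Proof. by rewrite /grow_rule /= eqxx. Qed.

Lemma grow_eqr lam mu : grow_rule 0%R lam mu lam = mu.
Proof. by rewrite /grow_rule /= eqxx orbT; case: eqP => // ->. Qed.

Lemma grow_disjoint lam mu nu : dstep lam mu -> dstep lam nu ->
  [seq c <- skew_cells nu lam | c \in skew_cells mu lam] = [::] ->
  grow_rule 0%R lam mu nu = punion nu mu.
Proof.
move=> /dstep_neq nm /dstep_neq nn e.
by rewrite /grow_rule /= (negPf nm) (negPf nn) /= e.
Qed.

Lemma grow_overlap lam mu nu c : dstep lam mu -> dstep lam nu ->
  [seq c <- skew_cells nu lam | c \in skew_cells mu lam] = [:: c] ->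
  grow_rule 0%R lam mu nu = add_cell (punion nu mu) (c.1.+1, c.2.+1).
Proof.
move=> /dstep_neq nm /dstep_neq nn e.
by rewrite /grow_rule /= (negPf nm) (negPf nn) /= e.
Qed.

Lemma skew_uniq lam nu : is_part nu -> dstep lam nu -> uniq (skew_cells nu lam).
Proof.
move=> pn [k h|k v]; rewrite ?(skew_h pn h) ?(skew_v pn v) /= inE xpair_eqE.
  by rewrite eqxx ltn_eqF.
by rewrite ltn_eqF.
Qed.

Lemma grow_rule_swap lam mu nu : is_part mu -> is_part nu ->
  dstep lam mu -> dstep lam nu ->
  size [seq c <- skew_cells nu lam | c \in skew_cells mu lam] <= 1 ->
  grow_rule 0%R lam nu mu = grow_rule 0%R lam mu nu.
Proof.
move=> pm pn dm dn le1.
have e : [seq c <- skew_cells mu lam | c \in skew_cells nu lam] =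
         [seq c <- skew_cells nu lam | c \in skew_cells mu lam].
  (* With at most one common cell, the order in which each skew shape lists its cells is
     irrelevant. *)
  apply: perm_small_eq => //; apply: uniq_perm.
  - exact: filter_uniq (skew_uniq pm dm).
  - exact: filter_uniq (skew_uniq pn dn).
  by move=> c; rewrite !mem_filter andbC.
case def: {1}[seq c <- skew_cells nu lam | c \in skew_cells mu lam] (le1) => [|c [|]] // _.
  by rewrite !grow_disjoint // ?e // punionC.
by rewrite !(@grow_overlap _ _ _ c) // ?e // punionC.
Qed.

Lemma grow_same_h k lam nu : is_part nu -> hstep k lam nu ->
  grow_rule 0%R lam nu nu = set_nth 0 nu k.+1 (prow nu k.+1).+2.
Proof.
move=> pn h; have ne := dstep_neq (DHoriz h).
rewrite /grow_rule /= (negPf ne) /= (skew_h pn h) /= !inE !eqxx orbT /=.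
by rewrite ltn_eqF.
Qed.

Lemma grow_same_v k lam nu : is_part nu -> vstep k lam nu ->
  let l := (prow lam k).+1 in let h := col_len nu l in
  grow_rule 0%R lam nu nu = add_cell (add_cell nu (h, l)) (h.+1, l).
Proof.
move=> pn v; have ne := dstep_neq (DVert v).
by rewrite /grow_rule /= (negPf ne) /= (skew_v pn v) /= !inE !eqxx orbT.
Qed.

(** Rows weakly decrease, so those reaching column [l] form an initial segment, and counting them
    locates the bottom of the column. *)
Lemma col_lenP p l i : is_part p -> (i < col_len p l) = (l < prow p i).
Proof.
rewrite /col_len; elim: p i => [|x p IH] i pp; first by rewrite /prow nth_nil.
have pp' : is_part p by split=> j; [apply: (pp.1 j.+1) | apply: (pp.2 j.+1)].
case: i => [|i] /=; last first.
  rewrite -[RHS](IH i pp'); case: (ltnP l x) => //= le.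
  have -> : count (fun y => l < y) p = 0.
    apply/eqP; rewrite -leqn0 leqNgt IH // -leqNgt.
    by apply: leq_trans le; apply: (pp.1 0).
  by [].
rewrite /prow /=; case: (ltnP l x) => //= le.
rewrite add0n IH //; apply/negbTE; rewrite -leqNgt.
by apply: leq_trans le; apply: (pp.1 0).
Qed.

(** Row [k.+1] of [nu] is that of [lam], hence at least two cells shorter than row [k] of [nu], and
    the appended domino fits. *)
Lemma grow_hh k lam mu nu : is_part lam -> is_part mu -> is_part nu ->
  hstep k lam mu -> hstep k lam nu ->
  let rho := grow_rule 0%R lam mu nu in
  [/\ mu = nu, is_part rho & hstep k.+1 nu rho].
Proof.
move=> pl pm pn hm hn rho.
have emn : mu = nu by apply: part_ext => // i; rewrite hm hn.
have er : rho = set_nth 0 nu k.+1 (prow nu k.+1).+2.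
  by rewrite /rho emn (grow_same_h pn hn).
have h : hstep k.+1 nu rho.
  by move=> i; rewrite er prow_set_nth; case: eqP => [->|_]; lia.
split=> //; rewrite er; apply: is_part_set_nth => // i.
rewrite -er !h !hn eqSS.
by have := pl.1 i; have := pn.1 i; rewrite !hn; case: (i =P k) => [->|]; lia.
Qed.

(** The new domino sits at the bottom of the column just right of the old one. Its column
    [prow nu h] is recorded because its parity is opposite to that of [prow lam k]. *)
Lemma grow_vv k lam mu nu : is_part lam -> is_part mu -> is_part nu ->
  vstep k lam mu -> vstep k lam nu ->
  let rho := grow_rule 0%R lam mu nu in
  [/\ mu = nu, is_part rho &
      exists2 h, vstep h nu rho & prow nu h = (prow lam k).+1].
Proof.
move=> pl pm pn vm vn rho.
have emn : mu = nu by apply: part_ext => // i; rewrite vm.2 vn.2.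
move: (grow_same_v pn vn) => /=.
set l := (prow lam k).+1; set h := col_len nu l => er.
have nuk : prow nu k = l by rewrite vn.2 eqxx addn1.
have nuk1 : prow nu k.+1 = l by rewrite vn.2 eqxx orbT addn1 vn.1.
have lehk : h <= k by rewrite leqNgt col_lenP // nuk ltnn.
(* Rows from [h] on do not reach column [l], while row [k.+1] already has length [l]. As [h <= k],
   both rows [h] and [h.+1] have length exactly [l], so a vertical domino fits there. *)
have nuh j : h <= j -> j <= k.+1 -> prow nu j = l.
  move=> le1 le2; apply/eqP; rewrite eqn_leq -{2}nuk1 prow_anti // andbT.
  by rewrite leqNgt -col_lenP // -leqNgt.
have h0 := nuh h (leqnn _) (leqW lehk).
have h1 := nuh h.+1 (leqW (leqnn _)) lehk.
have big j : j < h -> l < prow nu j by rewrite col_lenP.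
set x := add_cell nu (h, l).
have px i : prow x i = prow nu i + (i == h).
  by rewrite prow_set_nth /= h0; case: eqP => [->|_]; lia.
have rr : rho = add_cell x (h.+1, l) by rewrite /rho emn.
have pr i : prow rho i = prow nu i + ((i == h) || (i == h.+1)).
  rewrite rr prow_set_nth /= !px; case: (i =P h.+1) => [->|_]; last by rewrite orbF.
  by rewrite h1 orbT; lia.
have partx : is_part x.
  apply: is_part_set_nth => // [|i]; first by rewrite leq_max orbT.
  rewrite -/x; change (prow x i.+1 <= prow x i); rewrite !px; have := pn.1 i.
  by case: (i.+1 =P h) => [e|]; [have := big i; rewrite e h0; lia|lia].
split=> //.
  rewrite rr; apply: is_part_set_nth => // [|i]; first by rewrite leq_max orbT.
  change (prow (add_cell x (h.+1, l)) i.+1 <= prow (add_cell x (h.+1, l)) i).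
  rewrite -rr !pr; have := pn.1 i.
  case: (i.+1 =P h) => [e|]; first by have := big i; rewrite e h0; lia.
  case: (i =P h) => [->|]; rewrite ?h0 ?h1; lia.
by exists h => //; split=> //; rewrite h1 h0.
Qed.

(** The dominoes share the cell [(k, prow lam k)], and the extra cell completes a 2 by 2 block. The
    opposite edges are then its right column and its lower row. *)
Lemma grow_hv k lam mu nu : is_part lam -> is_part mu -> is_part nu ->
  vstep k lam mu -> hstep k lam nu ->
  let rho := grow_rule 0%R lam mu nu in
  [/\ is_part rho, vstep k mu rho, hstep k.+1 nu rho &
      grow_rule 0%R lam nu mu = rho].
Proof.
move=> pl pm pn vm hn rho; have [dm dn] := (DVert vm, DHoriz hn).
have common : [seq c <- skew_cells nu lam | c \in skew_cells mu lam] =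
              [:: (k, prow lam k)].
  rewrite (skew_v pm vm) (skew_h pn hn) /= !inE !xpair_eqE !eqxx /=.
  by rewrite [k == _]ltn_eqF // [_.+1 == _]gtn_eqF.
have er : rho = add_cell (punion nu mu) (k.+1, (prow lam k).+1).
  exact: grow_overlap common.
have [ek em] := vm.
have pr i : prow rho i = prow lam i + ((i == k) || (i == k.+1)).*2.
  rewrite er prow_set_nth !prow_punion /= !hn !em.
  case: (i =P k.+1) => [->|_]; rewrite ?eqxx ?ek; first by rewrite gtn_eqF //=; lia.
  by case: (i =P k) => [->|_]; rewrite ?eqxx /=; lia.
split.
- rewrite er; apply: is_part_set_nth => [||i].
  + exact: is_part_punion.
  + by rewrite leq_max orbT.
  set x := set_nth _ _ _ _; have -> : x = rho by rewrite er.
  rewrite !pr; have := pl.1 i; have := pn.1 i; rewrite !hn.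
  by case: (i =P k) => [->|ne]; [|case: (i =P k.+1) => [e|ne']]; lia.
- split=> [|i]; rewrite ?pr !em; first by rewrite !eqxx ek orbT.
  by case: eqP; case: eqP; lia.
- by move=> i; rewrite pr hn; case: (i =P k); case: (i =P k.+1); lia.
- by apply: grow_rule_swap => //; rewrite common.
Qed.

(** When no row is lengthened by both steps, the union adds the increments row by row, so each
    domino reappears on the opposite edge. *)
Lemma grow_punion lam mu nu : is_part mu -> is_part nu ->
  dstep lam mu -> dstep lam nu ->
  [seq c <- skew_cells nu lam | c \in skew_cells mu lam] = [::] ->
  (forall i, prow mu i = prow lam i \/ prow nu i = prow lam i) ->
  let rho := grow_rule 0%R lam mu nu in
  [/\ is_part rho, forall i, prow rho i + prow lam i = prow mu i + prow nu i &
      grow_rule 0%R lam nu mu = rho].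
Proof.
move=> pm pn dm dn disj rows rho; rewrite /rho (grow_rule_swap pm pn dm dn) ?disj //.
rewrite (grow_disjoint dm dn disj); split=> //; first exact: is_part_punion.
have ge a : dstep lam a -> forall i, prow lam i <= prow a i.
  by case=> k; last case=> _; move=> h i; rewrite h leq_addr.
move=> i; rewrite prow_punion; have := ge _ dm i; have := ge _ dn i.
by case: (rows i) => ->; lia.
Qed.

Lemma hstep_transport k lam mu nu rho : hstep k lam nu ->
  (forall i, prow rho i + prow lam i = prow mu i + prow nu i) -> hstep k mu rho.
Proof. by move=> h e i; have := e i; rewrite h; lia. Qed.

Lemma vstep_transport k lam mu nu rho : vstep k lam nu ->
  prow mu k = prow lam k -> prow mu k.+1 = prow lam k.+1 ->
  (forall i, prow rho i + prow lam i = prow mu i + prow nu i) -> vstep k mu rho.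
Proof.
move=> [ek h] ek0 ek1 e; split=> [|i]; first by rewrite ek0 ek1.
by have := e i; rewrite h; lia.
Qed.

(** Cases on the two orientations and on whether the top rows agree. Equal top rows give a repeated
    domino or a 2 by 2 block; otherwise the dominoes share no row and are transported unchanged.
    Each case preserves the number of vertical edges. *)
Lemma grow_two_steps lam mu nu : is_part lam -> is_part mu -> is_part nu ->
  dstep lam mu -> dstep lam nu ->
  let rho := grow_rule 0%R lam mu nu in
  [/\ is_part rho, dstep mu rho, dstep nu rho,
      vert lam mu + vert lam nu = vert mu rho + vert nu rho &
      grow_rule 0%R lam nu mu = rho].
Proof.
move=> pl pm pn dm dn rho.
have core := grow_punion pm pn dm dn.
case: (dm) (dn) => [k hm|k vm] [k' hn|k' vn]; have [ek|ne] := eqVneq k' k.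
- rewrite {}ek in hn; have [emn pr hr] := grow_hh pl pm pn hm hn.
  have hr' : hstep k.+1 mu rho by rewrite emn.
  split=> //; try by [apply: DHoriz; eassumption | rewrite /rho emn].
  by rewrite (vert_h hm) (vert_h hn) (vert_h hr) (vert_h hr').
- case: core => [|i|pr er sw].
  + rewrite (skew_h pm hm) (skew_h pn hn) /= !inE !xpair_eqE.
    by rewrite (negPf ne).
  + by rewrite hm hn; case: (i =P k) ne => [->|]; lia.
  have hr := hstep_transport hn er.
  have hr' : hstep k nu rho by apply: (hstep_transport hm) => i; rewrite er addnC.
  split=> //; try by [apply: DHoriz; eassumption | rewrite /rho emn].
  by rewrite (vert_h hm) (vert_h hn) (vert_h hr) (vert_h hr').
- rewrite {}ek in vn; have [pr vr hr sw] := grow_hv pl pn pm vn hm.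
  rewrite /rho sw.
  split=> //; [exact: DHoriz hr|exact: DVert vr|].
  by rewrite (vert_h hm) (vert_h hr) (vert_v pn vn) (vert_v pr vr).
(* The vertical step makes rows [k'] and [k'.+1] of [lam] equal, so lengthening only the lower one
   would not leave a partition. *)
- have ne1 : k != k'.+1.
    apply/eqP=> e; have := pm.1 k'; have := vn.1.
    by rewrite !hm e; lia.
  case: core => [|i|pr er sw].
  + rewrite (skew_h pm hm) (skew_v pn vn) /= !inE !xpair_eqE.
    by rewrite (negPf ne) [k'.+1 == _]eq_sym (negPf ne1).
  + by rewrite hm vn.2; lia.
  have hr : hstep k nu rho by apply: (hstep_transport hm) => i; rewrite er addnC.
  have vr : vstep k' mu rho.
    by apply: (vstep_transport vn _ _ er); rewrite hm; lia.
  split=> //; [exact: DVert vr|exact: DHoriz hr|].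
  by rewrite (vert_h hm) (vert_h hr) (vert_v pn vn) (vert_v pr vr).
- rewrite {}ek in hn; have [pr vr hr sw] := grow_hv pl pm pn vm hn.
  split=> //; [exact: DVert vr|exact: DHoriz hr|].
  by rewrite (vert_h hn) (vert_h hr) (vert_v pm vm) (vert_v pr vr).
- have ne1 : k' != k.+1.
    apply/eqP=> e; have := pn.1 k; have := vm.1.
    by rewrite !hn e; lia.
  case: core => [|i|pr er sw].
  + rewrite (skew_v pm vm) (skew_h pn hn) /= !inE !xpair_eqE.
    by rewrite (negPf ne) (negPf ne1).
  + by rewrite hn vm.2; lia.
  have hr := hstep_transport hn er.
  have vr : vstep k nu rho.
    by apply: (vstep_transport vm) => [||i]; rewrite ?er ?hn; lia.
  split=> //; [exact: DHoriz hr|exact: DVert vr|].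
  by rewrite (vert_h hn) (vert_h hr) (vert_v pm vm) (vert_v pr vr).
- rewrite {}ek in vn; have [emn pr [h vr _]] := grow_vv pl pm pn vm vn.
  have vr' : vstep h mu rho by rewrite emn.
  split=> //; try by [apply: DVert; eassumption | rewrite /rho emn].
  by rewrite (vert_v pm vm) (vert_v pn vn) (vert_v pr vr) (vert_v pr vr').
(* Vertical dominoes shifted by one row would need three equal rows in [lam], and the lower domino
   could not be added alone. *)
- have ne1 : k' != k.+1.
    apply/eqP=> e; have := pn.1 k; have := vm.1; have := vn.1.
    by rewrite !vn.2 e; lia.
  have ne2 : k != k'.+1.
    apply/eqP=> e; have := pm.1 k'; have := vm.1; have := vn.1.
    by rewrite !vm.2 e; lia.
  case: core => [|i|pr er sw].
  + rewrite (skew_v pm vm) (skew_v pn vn) /= !inE !xpair_eqE eqSS.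
    by rewrite (negPf ne) (negPf ne1) [k'.+1 == _]eq_sym (negPf ne2).
  + by rewrite vm.2 vn.2; lia.
  have vr : vstep k nu rho.
    by apply: (vstep_transport vm) => [||i]; rewrite ?er ?vn.2; lia.
  have vr' : vstep k' mu rho.
    by apply: (vstep_transport vn _ _ er); rewrite vm.2; lia.
  split=> //; try by [apply: DVert; eassumption | rewrite /rho emn].
  by rewrite (vert_v pm vm) (vert_v pn vn) (vert_v pr vr) (vert_v pr vr').
Qed.

(** Horizontal dominoes keep row parities; two vertical ones in adjacent columns contribute +2 and
    -2. *)
Lemma grow_diag lam nu : is_part lam -> is_part nu -> dstep lam nu ->
  oddrows (grow_rule 0%R lam nu nu) = oddrows lam.
Proof.
move=> pl pn [k h|k v].
  have [_ pr hr] := grow_hh pl pn pn h h.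
  by rewrite (oddrows_h hr) (oddrows_h h).
have [_ pr [k' vr e]] := grow_vv pl pn pn v v.
have := oddrows_v pn v; have := oddrows_v pr vr; rewrite e /=.
by case: odd => /=; lia.
Qed.

(** * Growth diagrams *)

Definition estep (lam mu : seq nat) : Prop := lam = mu \/ dstep lam mu.

Lemma evert_refl p : evert p p = false.
Proof. by apply/hasP=> -[i _]; rewrite ltn_eqF. Qed.

Lemma oddrows_e lam mu : is_part mu -> estep lam mu ->
  oddrows mu + 4 * evert lam mu = oddrows lam + 2 * vert lam mu.
Proof.
move=> pm [->|]; last exact: oddrows_d.
by rewrite evert_refl vert_refl.
Qed.

(** A barred entry creates one vertical domino seen on both outgoing edges, hence the term 2. The
    last clause serves to show that an edge, once a domino, stays one in all later rows. *)
Lemma grow_cell m lam mu nu : is_part lam -> is_part mu -> is_part nu ->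
  estep lam mu -> estep lam nu ->
  m = 0%R \/ [/\ m = 1%R \/ m = (-1)%R, lam = mu & lam = nu] ->
  let rho := grow_rule m lam mu nu in
  [/\ is_part rho /\ grow_rule m lam nu mu = rho, estep mu rho, estep nu rho,
      vert lam mu + vert lam nu + 2 * (m == -1)%R = vert mu rho + vert nu rho &
      (mu == rho) = (lam == nu) && (m == 0)%R].
Proof.
move=> pl pm pn em en; case=> [->|[hm <- <-]]; last first.
  rewrite eqxx vert_refl; case: hm => ->.
    have [pr h] := grow_pos lam lam pl.
    split=> //; try by right; apply: DHoriz; exact: h.
      by rewrite (vert_h h).
    by apply/negbTE/dstep_neq/DHoriz/h.
  have [pr v] := grow_neg lam lam pl.
  split=> //; try by right; apply: DVert; exact: v.
    by rewrite (vert_v pr v).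
  by apply/negbTE/dstep_neq/DVert/v.
case: em => [<-|dm]; last first.
  case: en => [<-|dn].
    rewrite grow_eqr eqxx; split; rewrite ?grow_eql ?vert_refl ?eqxx ?addn0 //.
      by left.
    by right.
  have [pr d1 d2 e1 e2] := grow_two_steps pl pm pn dm dn.
  split; rewrite ?addn0 //; try by right.
  by rewrite !(negPf (dstep_neq _)).
rewrite grow_eql; split; rewrite ?grow_eqr ?vert_refl ?eqxx ?andbT ?addn0 //.
by left.
Qed.

(** For a nonzero entry the rule reads only [lam]; the domino of a barred entry is in column 0,
    which is even, so two odd rows appear. *)
Lemma oddrows_cell m lam nu : is_part lam -> is_part nu -> estep lam nu ->
  m = 0%R \/ (m = 1%R \/ m = (-1)%R) ->
  oddrows (grow_rule m lam nu nu) = oddrows lam + 2 * (m == -1)%R.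
Proof.
move=> pl pn en [->|[->|->]].
- case: en => [<-|dn]; first by rewrite grow_eql addn0.
  by rewrite grow_diag // addn0.
- by have [_ h] := grow_pos nu nu pl; rewrite (oddrows_h h) addn0.
have [pr v] := grow_neg nu nu pl.
by have := oddrows_v pr v; rewrite prow_default // muln0 addn0.
Qed.

Section Grid.
Variables (r : nat) (M : nat -> nat -> int).

(* Unlike [growth_row], not truncated at [n]. *)
Fixpoint grid (i : nat) : nat -> seq nat :=
  if i isn't i'.+1 then fun=> delta r else
  fix row j := if j isn't j'.+1 then delta r else
    grow_rule (M i' j') (grid i' j') (row j') (grid i' j'.+1).

Lemma gridS i j : grid i.+1 j.+1 =
  grow_rule (M i j) (grid i j) (grid i.+1 j) (grid i j.+1).
Proof. by []. Qed.

Lemma grid_0r i : grid i 0 = delta r. Proof. by case: i. Qed.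

Lemma growth_rowE n i : growth_row r M n i = [seq grid i j | j <- iota 0 n.+1].
Proof.
elim: i => [|i IH].
  have E m k : [seq grid 0 j | j <- iota k m] = nseq m (delta r).
    by elim: m k => //= m IHm k; rewrite IHm.
  exact: esym (E _ _).
rewrite [LHS]/= IH -(grid_0r i.+1) -/(iota 0 n.+1).
(* The starting column is generalized so that the induction can peel off the head of the row. *)
move: {IH}0; elim: n => [|n IHn] j //.
by have := congr1 (cons (grid i.+1 j)) (IHn j.+1); apply: etrans.
Qed.

Arguments grid : simpl never.

Hypothesis part_delta : is_part (delta r).
Hypothesis Mval : forall i j, M i j = 0%R \/ (M i j = 1%R \/ M i j = (-1)%R).
(** Though one-sided, this and [Mcol] say that each row and each column has at most one nonzero
    entry. *)
Hypothesis Mrow : forall i j j', M i j <> 0%R -> j' < j -> M i j' = 0%R.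
Hypothesis Mcol : forall i i' j, M i j <> 0%R -> i' < i -> M i' j = 0%R.

Lemma grid_row0 i j : (forall j', j' < j -> M i j' = 0%R) ->
  grid i.+1 j = grid i j.
Proof.
elim: j => [|j IH] z; first by rewrite !grid_0r.
by rewrite gridS z // IH ?grow_eql // => j' lt; apply: z; apply: ltnW.
Qed.

Lemma grid_col0 i j : (forall i', i' < i -> M i' j = 0%R) ->
  grid i j.+1 = grid i j.
Proof.
elim: i => [|i IH] z //.
by rewrite gridS z // IH ?grow_eqr // => i' lt; apply: z; apply: ltnW.
Qed.

(** Before its nonzero entry a row of squares only copies the previous row of partitions, and
    likewise for columns; so the three known corners agree at a nonzero entry. *)
Lemma grid_cell_hyp i j :
  M i j = 0%R \/ [/\ M i j = 1%R \/ M i j = (-1)%R,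
                     grid i j = grid i.+1 j & grid i j = grid i j.+1].
Proof.
have [e|/eqP ne] := eqVneq (M i j) 0%R; [by left|right].
split; first by case: (Mval i j).
  by rewrite grid_row0 // => j'; apply: Mrow.
by rewrite grid_col0 // => i'; apply: Mcol.
Qed.

(** Nested induction: the horizontal edges of row [k] yield, column by column, the vertical edges
    down to row [k.+1], which in turn yield its horizontal edges. *)
Lemma grid_inv i j :
  [/\ is_part (grid i j), estep (grid i j) (grid i.+1 j) &
      estep (grid i j) (grid i j.+1)].
Proof.
suff H : (forall j, is_part (grid i j) /\ estep (grid i j) (grid i j.+1)) /\
  (forall j, is_part (grid i.+1 j) /\ estep (grid i j) (grid i.+1 j)).
  by have [[pp e1] [_ e2]] := (H.1 j, H.2 j).
have row k : (forall j, is_part (grid k j) /\ estep (grid k j) (grid k j.+1)) ->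
  forall j, is_part (grid k.+1 j) /\ estep (grid k j) (grid k.+1 j).
  move=> IH; elim=> [|l [pm em]]; first by rewrite !grid_0r; split=> //; left.
  have [[pl en] [pn _]] := (IH l, IH l.+1).
  by have [[pr _] _ er _ _] := grow_cell pl pm pn em en (grid_cell_hyp k l).
suff H : forall j, is_part (grid i j) /\ estep (grid i j) (grid i j.+1).
  by split=> //; apply: row.
elim: i => [|i IH] {}j; first by split=> //; left.
have [pm em] := row i IH j; split=> //.
have [[pl en] [pn _]] := (IH j, IH j.+1).
by have [_ er _ _ _] := grow_cell pl pm pn em en (grid_cell_hyp i j).
Qed.

Lemma grid_cell i j :
  let rho := grid i.+1 j.+1 in
  [/\ grow_rule (M i j) (grid i j) (grid i j.+1) (grid i.+1 j) = rho,
      vert (grid i j) (grid i.+1 j) + vert (grid i j) (grid i j.+1) +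
        2 * (M i j == -1)%R = vert (grid i.+1 j) rho + vert (grid i j.+1) rho &
      (grid i.+1 j == rho) = (grid i j == grid i j.+1) && (M i j == 0)%R].
Proof.
have [pl em en] := grid_inv i j.
have [[pm _ _] [pn _ _]] := (grid_inv i.+1 j, grid_inv i j.+1).
by have [[]] := grow_cell pl pm pn em en (grid_cell_hyp i j).
Qed.

Lemma grid_neq i j k : M i j <> 0%R -> i < k -> grid k j != grid k j.+1.
Proof.
move=> ne; elim: k => // k IH; rewrite ltnS leq_eqVlt.
have [_ _ ->] := grid_cell k j.
by case/predU1P => [<-|/IH/negPf -> //]; rewrite andbC; case: eqP.
Qed.

Lemma grid_dstep i j k : M i j <> 0%R -> i < k ->
  dstep (grid k j) (grid k j.+1).
Proof.
move=> ne lt; have [_ _ []//] := grid_inv k j.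
by move=> e; have := grid_neq ne lt; rewrite -e eqxx.
Qed.

(** The square balances telescope along the row: inner vertical edges cancel, and the leftmost one
    is constant. *)
Lemma vert_row n i :
  \sum_(j < n) vert (grid i.+1 j) (grid i.+1 j.+1) +
    vert (grid i n) (grid i.+1 n) =
  \sum_(j < n) vert (grid i j) (grid i j.+1) + 2 * \sum_(j < n) (M i j == -1)%R.
Proof.
elim: n => [|n IH]; first by rewrite !big_ord0 !grid_0r vert_refl.
rewrite !big_ord_recr mulnDr /=; have [_ e _] := grid_cell i n.
by move: IH e => /=; lia.
Qed.

Lemma vert_total n m :
  \sum_(j < n) vert (grid m j) (grid m j.+1) +
    \sum_(i < m) vert (grid i n) (grid i.+1 n) =
  2 * \sum_(i < m) \sum_(j < n) (M i j == -1)%R.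
Proof.
elim: m => [|m IH].
  by rewrite !big_ord0 big1 // => j _; rewrite vert_refl.
by rewrite !(big_ord_recr m) mulnDr -IH /= addnCA vert_row addnCA addnA.
Qed.

Lemma oddrows_row n m : oddrows (grid m n) +
    4 * \sum_(j < n) evert (grid m j) (grid m j.+1) =
  oddrows (delta r) + 2 * \sum_(j < n) vert (grid m j) (grid m j.+1).
Proof.
elim: n => [|n IH]; first by rewrite !big_ord0 grid_0r.
have [_ _ e] := grid_inv m n; have [pn _ _] := grid_inv m n.+1.
rewrite !(big_ord_recr n) !mulnDr /= addnCA (oddrows_e pn e).
by rewrite addnA [4 * _ + _]addnC IH -addnA.
Qed.

Hypothesis Msym : forall i j, M i j = M j i.

(** The rule is symmetric in [mu] and [nu] on the squares that occur, so the transposed array obeys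
    the same recursion. *)
Lemma grid_sym i j : grid i j = grid j i.
Proof.
elim: i j => [|i IH] j; first by rewrite grid_0r.
elim: j => [|j IHj]; first by rewrite grid_0r.
have [<- _ _] := grid_cell i j.
by rewrite gridS Msym IH IHj -(IH j.+1).
Qed.

Lemma oddrows_diag n :
  oddrows (grid n n) = oddrows (delta r) + 2 * \sum_(i < n) (M i i == -1)%R.
Proof.
elim: n => [|n IH]; first by rewrite big_ord0 addn0.
have [[pl em en] [pn _ _]] := (grid_inv n n, grid_inv n n.+1).
rewrite gridS (grid_sym n.+1 n) oddrows_cell // IH.
by rewrite big_ord_recr /= mulnDr addnA.
Qed.

Lemma evert_total n :
  \sum_(i < n) (M i i == -1)%R +
    2 * \sum_(j < n) evert (grid n j) (grid n j.+1) =
  \sum_(i < n) \sum_(j < n) (M i j == -1)%R.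
Proof.
(* Computing the odd rows of the corner along the diagonal and along the last row gives
   [2 F + 4 E = 2 V]; by symmetry [vert_total] reads [2 V = 2 S]. *)
have := oddrows_row n n; rewrite oddrows_diag -addnA => /addnI.
have := vert_total n n; rewrite [X in _ + X](eq_bigr
  (fun j : 'I_n => vert (grid n j) (grid n j.+1) : nat)); last first.
  by move=> j _; rewrite !(grid_sym n).
set V := \sum_(j < n) vert _ _; set E := \sum_(j < n) evert _ _.
set F := \sum_(i < n) nat_of_bool _; set S := \sum_(i < n) \sum_(j < n) _.
by move: V E F S => V E F S; lia.
Qed.
End Grid.

(** * The sign of a domino tableau *)

Fixpoint invs (w : seq nat) : nat :=
  if w is x :: w' then count (fun y => y < x) w' + invs w' else 0.

Lemma inversionsE w : inversions w = invs w.
Proof.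
elim: w => [|x w IH]; first by rewrite /inversions big_ord0.
rewrite /= -IH /inversions big_ord_recl; congr (_ + _).
  rewrite big_mkcond big_ord_recl /= add0n -sum1_count (big_nth 0) big_mkord.
  by rewrite [RHS]big_mkcond; apply: eq_bigr => i _; case: ltnP.
apply: eq_bigr => i _; rewrite big_mkcond big_ord_recl /= add0n.
by rewrite [RHS]big_mkcond.
Qed.

(** A strict maximum is inverted with exactly the letters after it. *)
Lemma invs_insert_max A x B : all (fun a => a < x) (A ++ B) ->
  invs (A ++ x :: B) = invs (A ++ B) + size B.
Proof.
elim: A => [|a A IH] /=.
  by rewrite all_count addnC => /eqP ->.
case/andP=> ax /IH ->; rewrite addnA !count_cat /= ltnNge (ltnW ax) //.
Qed.

(* The bound [N] may exceed [size p]: this lets two partitions share a row range. *)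
Definition cells (N : nat) (p : seq nat) : seq (nat * nat) :=
  flatten [seq [seq (k, l) | l <- iota 0 (prow p k)] | k <- iota 0 N].

Lemma mem_cells N p x : x \in cells N p -> in_part p x.
Proof.
by case/flatten_mapP=> k _ /mapP[l]; rewrite mem_iota => lt -> /=.
Qed.

Lemma cellsE N p : size p <= N -> cells N p = cells (size p) p.
Proof.
move=> le; rewrite /cells -{1}(subnKC le) iotaD map_cat flatten_cat.
rewrite [X in _ ++ X]flatten_nil ?cats0 // => i.
by rewrite mem_iota => /andP[/prow_default ->].
Qed.

Lemma reading_wordE r ch :
  reading_word r ch =
  [seq tableau_entry r ch x | x <- cells (size (last [::] ch)) (last [::] ch)].
Proof.
rewrite /reading_word /cells map_flatten -map_comp; congr flatten.
by apply: eq_map => k /=; rewrite -map_comp.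
Qed.

Definition precedes (x y : nat * nat) : bool :=
  ((x.1 == y.1) && (x.2 < y.2)) || ((x.2 == y.2) && (x.1 < y.1)).

(** [C] is what is read between the two new cells: nothing for a horizontal domino, and for a
    vertical one the old row [k.+1], whose length is the column of the domino. *)
Lemma cells_step N lam mu : is_part lam -> is_part mu -> dstep lam mu ->
  size mu <= N ->
  exists A C B x y,
    [/\ cells N lam = A ++ C ++ B, cells N mu = A ++ x :: C ++ y :: B,
        skew_cells mu lam = [:: x; y], odd (size C) = evert lam mu &
        [/\ precedes x y, ~~ in_part lam x & ~~ in_part lam y]].
Proof.
move=> pl pm [k h|k v] leN.
  have ltk : k < N by rewrite (leq_trans (hstep_size pm h)).
  rewrite (skew_h pm h) (evert_h h) /cells (iota_split1 ltk).
  rewrite !map_cat !flatten_cat /= (h k) eqxx iotaD map_cat /= add0n -!catA.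
  set A := flatten _; set B := flatten _.
  set A' := flatten _; set B' := flatten _.
  have -> : A' = A.
    congr flatten; apply/eq_in_map => i; rewrite mem_iota => lt.
    by rewrite h ltn_eqF ?addn0.
  have -> : B' = B.
    congr flatten; apply/eq_in_map => i; rewrite mem_iota => lt.
    by rewrite h gtn_eqF ?addn0 //; lia.
  set R := [seq _ | _ <- iota 0 _].
  exists (A ++ R), [::], B, (k, prow lam k), (k, (prow lam k).+1).
  split=> //; rewrite -?catA //.
  by rewrite /precedes /in_part /= eqxx !ltnS leqnn -leqNgt leqnn -leqNgt leqnSn.
have ltk : k.+1 < N by rewrite (leq_trans (vstep_size pm v)).
rewrite (skew_v pm v) (evert_v pm v) /cells (iota_split1 (ltnW ltk)).
have -> : N - k.+1 = (N - k.+2).+1 by lia.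
rewrite !map_cat !flatten_cat /= !v.2 v.1 !eqxx orbT /= !iotaD !map_cat /= !add0n -!catA.
set A := flatten _; set B := flatten _.
set A' := flatten _; set B' := flatten _.
have -> : A' = A.
  congr flatten; apply/eq_in_map => i; rewrite mem_iota => lt.
  by rewrite v.2 !ltn_eqF ?addn0 //; lia.
have -> : B' = B.
  congr flatten; apply/eq_in_map => i; rewrite mem_iota => lt.
  by rewrite v.2 !gtn_eqF ?addn0 //; lia.
set R := [seq (k, _) | _ <- iota 0 _]; set C := [seq (k.+1, _) | _ <- iota 0 _].
exists (A ++ R), C, B, (k, prow lam k), (k.+1, prow lam k).
split=> //; rewrite -?catA // ?size_map ?size_iota //.
by rewrite /precedes /in_part /= eqxx ltnSn orbT v.1 -!leqNgt leqnn.
Qed.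

Lemma iota0S k : iota 0 k.+1 = iota 0 k ++ [:: k].
Proof. by rewrite -addn1 iotaD. Qed.

Section Chain.
Variables (r : nat) (c : nat -> seq nat) (n : nat).
Hypotheses (r_le1 : r <= 1) (c0 : c 0 = delta r).
Hypothesis partc : forall k, is_part (c k).
Hypothesis stepc : forall k, k < n -> dstep (c k) (c k.+1).

(** Prefixes of the chain, for an induction adding one domino at a time. *)
Let ch k := [seq c j | j <- iota 0 k.+1].

Lemma chain_le i j x : i <= j -> j <= n -> in_part (c i) x -> in_part (c j) x.
Proof.
elim: j => [|j IH]; first by rewrite leqn0 => /eqP ->.
rewrite leq_eqVlt => /predU1P[-> //|leij] ltj /(IH leij (ltnW ltj)).
have le k : prow (c j) k <= prow (c j.+1) k.
  by case: (stepc ltj) => i'; last case=> _; move=> ->; rewrite leq_addr.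
by rewrite /in_part => /leq_trans; apply; apply: le.
Qed.

Lemma domino_value_chain k x :
  domino_value (ch k) x = count (fun j => ~~ in_part (c j) x) (iota 0 k.+1).
Proof. by rewrite /domino_value /ch count_map. Qed.

Lemma domino_value_old k x : in_part (c k) x -> domino_value (ch k) x <= k.
Proof.
rewrite domino_value_chain => xk; rewrite iota0S count_cat [count _ [:: _]]/= xk !addn0.
by rewrite -[leqRHS](size_iota 0) count_size.
Qed.

Lemma domino_value_new k x : k < n -> ~~ in_part (c k) x -> in_part (c k.+1) x ->
  domino_value (ch k.+1) x = k.+1.
Proof.
move=> ltk xk xk1; rewrite domino_value_chain iota0S count_cat [count _ [:: _]]/= xk1 !addn0.
rewrite -[RHS](size_iota 0); apply/eqP; rewrite -all_count; apply/allP => j.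
rewrite mem_iota ltnS => le; apply: contra xk; apply: chain_le => //; exact: ltnW.
Qed.

Lemma nth_chain k m : m <= k -> nth [::] (ch k) m = c m.
Proof. by move=> le; rewrite (nth_map 0) ?size_iota // nth_iota. Qed.

Lemma tableau_entry_old k x : k < n -> in_part (c k) x ->
  tableau_entry r (ch k.+1) x = tableau_entry r (ch k) x.
Proof.
move=> ltk xk; have le := domino_value_old xk.
have e : domino_value (ch k.+1) x = domino_value (ch k) x.
  rewrite !domino_value_chain [in LHS]iota0S count_cat [count _ [:: _]]/=.
  by rewrite (chain_le _ _ xk) //= !addn0.
by rewrite /tableau_entry e !nth_chain //; lia.
Qed.

Lemma tableau_entry_le k x : in_part (c k) x ->
  tableau_entry r (ch k) x <= k.*2 + r.
Proof.
move=> xk; have le := domino_value_old xk; rewrite /tableau_entry.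
case: eqP => [e|_]; last by case: ifP; lia.
(* A core cell has entry 1, which could exceed the bound only for [k = 0] and [r = 0], where there
   is no cell. *)
case: k xk {le} e => [|k] x0 _; last by lia.
by move: x0; rewrite c0; case: (r) r_le1 => [|[|//]] _ //; rewrite /in_part /prow nth_nil.
Qed.

Lemma tableau_entry_new k x y : k < n ->
  skew_cells (c k.+1) (c k) = [:: x; y] -> precedes x y ->
  ~~ in_part (c k) x -> ~~ in_part (c k) y ->
  in_part (c k.+1) x -> in_part (c k.+1) y ->
  tableau_entry r (ch k.+1) x = k.*2.+1 + r /\
  tableau_entry r (ch k.+1) y = k.*2.+2 + r.
Proof.
move=> ltk dom prec nx ny x1 y1.
have nxy : x != y by apply: contraL prec => /eqP ->; rewrite /precedes !ltnn !andbF.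
rewrite /tableau_entry !domino_value_new // !nth_chain //= dom /= !eqxx /=.
rewrite [y == x]eq_sym (negPf nxy) /= -/(precedes x y) -/(precedes y x) prec.
suff -> : precedes y x = false by [].
by apply/negbTE; move: prec; rewrite /precedes; lia.
Qed.

Lemma reading_word_step k : k < n ->
  odd (invs (reading_word r (ch k.+1))) =
  odd (invs (reading_word r (ch k))) (+) evert (c k) (c k.+1).
Proof.
move=> ltk; have dk := stepc ltk.
rewrite !reading_wordE.
have last_ch m : last [::] (ch m) = c m.
  by rewrite (last_nth [::]) size_map size_iota; apply: (nth_chain (k := m)).
rewrite !last_ch -(@cellsE (size (c k) + size (c k.+1)) (c k)) ?leq_addr //.
rewrite -(@cellsE (size (c k) + size (c k.+1)) (c k.+1)) ?leq_addl //.
have [A [C [B [x [y [e0 e1 sk odC [prec nx ny]]]]]]] :=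
  cells_step (partc k) (partc k.+1) dk (leq_addl (size (c k)) _).
have mem1 z : z \in A ++ x :: C ++ y :: B -> in_part (c k.+1) z.
  by rewrite -e1; apply: mem_cells.
have mem0 z : z \in A ++ C ++ B -> in_part (c k) z.
  by rewrite -e0; apply: mem_cells.
have [ex ey] : tableau_entry r (ch k.+1) x = k.*2.+1 + r /\
               tableau_entry r (ch k.+1) y = k.*2.+2 + r.
  apply: tableau_entry_new => //; apply: mem1.
    by rewrite mem_cat mem_head orbT.
  by rewrite mem_cat inE mem_cat mem_head !orbT.
have old z : z \in A ++ C ++ B ->
  tableau_entry r (ch k.+1) z = tableau_entry r (ch k) z.
  by move/mem0; apply: tableau_entry_old.
rewrite e0 e1 -((eq_in_map _ _ _).1 old).
set f := tableau_entry r (ch k.+1) in ex ey old *.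
rewrite !map_cat /= map_cat /= ex ey.
have lt z : z \in A ++ C ++ B -> f z < k.*2.+1 + r.
  move=> zm; rewrite old // addSn ltnS tableau_entry_le //.
  exact: mem0.
have allx : all (fun a => a < k.*2.+1 + r) (map f A ++ map f C ++ map f B).
  by rewrite -!map_cat all_map; apply/allP => z /lt.
have ally : all (fun a => a < k.*2.+2 + r)
    ((map f A ++ k.*2.+1 + r :: map f C) ++ map f B).
  move: allx; rewrite !all_cat /= -!andbA => /and3P[a1 a2 a3].
  have w a : a < k.*2.+1 + r -> a < k.*2.+2 + r by move/ltn_trans; apply.
  by rewrite !(sub_all w) //= ltnSn.
(* Removing the larger letter first makes the other one maximal in turn. Together they account for
   [size C + 2 * size B] inversions, of the parity of [size C]. *)
rewrite -cat_cons catA invs_insert_max // -catA cat_cons.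
rewrite invs_insert_max // !(oddD, size_cat, size_map) odC.
by rewrite addbA addbK.
Qed.

Lemma sdt_sign_chain : sdt_sign r (ch n) =
  ((-1) ^+ \sum_(j < n) evert (c j) (c j.+1))%R.
Proof.
rewrite /sdt_sign inversionsE -signr_odd -[RHS]signr_odd; congr (_ ^+ nat_of_bool _)%R.
have : n <= n by []; elim: {-2}n => [_|k IH ltk].
  (* The core has at most one cell, so its reading word has no inversion. *)
  rewrite big_ord0 reading_wordE /= c0.
  by case: (r) r_le1 => [|[]].
by rewrite reading_word_step // big_ord_recr oddD /= IH ?oddb // ltnW.
Qed.
End Chain.

(** * Signed involutions *)

Lemma is_part_delta r : r <= 1 -> is_part (delta r).
Proof. by case: r => [|[]] // _; split=> [i|[|i]] //; rewrite /prow /= nth_nil. Qed.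

Section SignedMatrix.
Variables (n : nat) (sigma : {perm 'I_n}) (s : {ffun 'I_n -> bool}).
Let M := signed_matrix sigma s.

Lemma signed_matrixE (i j : 'I_n) :
  M i j = if sigma i == j then (if s i then (-1)%R else 1%R) else 0%R.
Proof. by rewrite /M /signed_matrix !valK. Qed.

Lemma signed_matrix_neq0 i j : M i j <> 0%R ->
  exists2 i' : 'I_n, i = i' & j = sigma i'.
Proof.
rewrite /M /signed_matrix; case: insubP => // i' _ <-; case: insubP => // j' _ <-.
by case: eqP => // <-; exists i'.
Qed.

Lemma signed_matrix_val i j : M i j = 0%R \/ (M i j = 1%R \/ M i j = (-1)%R).
Proof.
have [|/eqP ne] := eqVneq (M i j) 0%R; [by left|right].
have [i' ei ej] := signed_matrix_neq0 ne.
by rewrite ei ej signed_matrixE eqxx; case: (s i'); [right|left].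
Qed.

Lemma signed_matrix_row i j j' : M i j <> 0%R -> j' < j -> M i j' = 0%R.
Proof.
move=> /signed_matrix_neq0[k ei ->] lt; apply/eqP; apply: contraTT lt => /eqP.
move=> /signed_matrix_neq0[l ei' ->]; have -> : k = l by apply: val_inj; rewrite /= -ei.
by rewrite ltnn.
Qed.

Lemma signed_matrix_col i i' j : M i j <> 0%R -> i' < i -> M i' j = 0%R.
Proof.
move=> /signed_matrix_neq0[k -> ej] lt; apply/eqP; apply: contraTT lt => /eqP.
move=> /signed_matrix_neq0[l -> ej'].
have -> : k = l by apply/(@perm_inj _ sigma)/val_inj; rewrite /= -ej.
by rewrite ltnn.
Qed.

Hypothesis inv : signed_involution sigma s.

Lemma signed_involutionK k : sigma (sigma k) = k.
Proof.
by case: (inv k) => [[e _]|[[e _]|[l [_ [[-> [_ []]]|[-> [_ []]]]]]]]; rewrite ?e.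
Qed.

Lemma signed_involution_sign k : s (sigma k) = s k.
Proof.
by case: (inv k) => [[-> _]|[[-> _]|[l [_ [[-> [-> [_ ->]]]|[-> [-> [_ ->]]]]]]]].
Qed.

Lemma signed_matrix_sym i j : M i j = M j i.
Proof.
have half i' j' : M i' j' <> 0%R -> M j' i' = M i' j'.
  move=> /signed_matrix_neq0[k -> ->]; rewrite !signed_matrixE eqxx.
  by rewrite signed_involutionK eqxx signed_involution_sign.
have [e|/eqP/half //] := eqVneq (M i j) 0%R.
by have [->//|/eqP/half] := eqVneq (M j i) 0%R.
Qed.

Lemma bar_entryE (i j : 'I_n) : (M i j == (-1)%R) = s i && (sigma i == j).
Proof. by rewrite signed_matrixE; case: ifP; case: (s i). Qed.

(** Each bar is at a position [i] equal to, below or above [sigma i]. The first kind is diagonal,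
    and each barred two-cycle has one position of each other kind. *)
Lemma barred_count :
  \sum_(i < n) \sum_(j < n) (M i j == (-1)%R) =
  \sum_(i < n) (M i i == (-1)%R) + 2 * barred_two_cycles sigma s.
Proof.
have -> : barred_two_cycles sigma s = \sum_(i < n) (s i && (i < sigma i)).
  rewrite /barred_two_cycles.
  have -> : [set p : 'I_n * 'I_n | [&& p.1 < p.2, sigma p.1 == p.2,
                 sigma p.2 == p.1, s p.1 & s p.2]]
      = [set (i, sigma i) | i in [set i | s i && (i < sigma i)]].
    apply/setP => -[i j]; rewrite inE /=; apply/idP/imsetP.
      by case/and5P=> lt /eqP e _ si _; exists i; rewrite ?inE ?si e.
    case=> k; rewrite inE => /andP[sk lt] [-> ->].
    by rewrite lt eqxx signed_involutionK eqxx sk signed_involution_sign.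
  rewrite card_imset => [|i j [->] //]; rewrite -sum1_card big_mkcond /=.
  by apply: eq_bigr => i _; rewrite inE; case: (_ && _).
have -> : 2 * \sum_(i < n) (s i && (i < sigma i)) =
    \sum_(i < n) (s i && (i < sigma i)) + \sum_(i < n) (s i && (sigma i < i)).
  (* Reindexing by [sigma] exchanges the smaller and larger elements of the barred two-cycles. *)
  rewrite mul2n -addnn [X in _ = _ + X](reindex_inj (@perm_inj _ sigma)) /=.
  by congr (_ + _); apply: eq_bigr => i _; rewrite signed_involutionK signed_involution_sign.
rewrite -!big_split /=; apply: eq_bigr => i _.
rewrite (bigD1 (sigma i)) //= big1 => [|j ne]; last first.
  by rewrite bar_entryE eq_sym (negPf ne) andbF.
rewrite !bar_entryE eqxx andbT -val_eqE /=.
by case: (s i) => //=; case: ltngtP.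
Qed.
End SignedMatrix.

Theorem theorem4p4 (r n : nat) (hr : r <= 1) (sigma : {perm 'I_n})
  (s : {ffun 'I_n -> bool}) (d : nat) :
  signed_involution sigma s ->
  barred_two_cycles sigma s = d ->
  sdt_sign r (insertion_tableau r sigma s) = ((-1) ^+ d)%R.
Proof.
move=> inv <-; have pd := is_part_delta hr.
have Mval := signed_matrix_val sigma s.
have Mrow := @signed_matrix_row n sigma s.
have Mcol := @signed_matrix_col n sigma s.
rewrite /insertion_tableau growth_rowE (sdt_sign_chain hr).
- congr (_ ^+ _)%R.
  have := evert_total pd Mval Mrow Mcol (signed_matrix_sym inv) n.
  (* Cancelling the barred fixed points makes the exponents equal as integers, not only modulo 2. *)
  by rewrite barred_count // => /addnI; lia.
- exact: grid_0r.
- by move=> k; case: (grid_inv pd Mval Mrow Mcol n k).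
(* Column [j] has its nonzero entry in the row of the preimage of [j], above the last row of
   partitions, so the edge there is a domino. *)
move=> j ltj; have [i ei] : exists i, sigma i = Ordinal ltj.
  by exists ((sigma^-1)%g (Ordinal ltj)); rewrite permKV.
apply: (grid_dstep pd Mval Mrow Mcol (i := i)) => //.
rewrite -[j]/(val (Ordinal ltj)) -ei signed_matrixE eqxx.
by case: (s i).
Qed.
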